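(* Consider an open quantum system on a finite-dimensional Hilbert space $\mathcal H$ with Hamiltonian $H$. Let $W_1,\dots,W_N$ be observables commuting with $H$, each positive semidefinite with smallest eigenvalue $0$; for $n\in\{1,\dots,N\}$ let $\widetilde W_n=\sum_{\lambda=1}^nW_\lambda$ and let $d_n$ be the smallest eigenvalue of $\widetilde W_n$. Fix $n<N$. Suppose that with coupling operators $L_1,\dots,L_M$ one has $\mathcal G_M(\widetilde W_n-d_n)\le-c(\widetilde W_n-d_n)$ for some $c>0$, where $\mathcal G_M(X)=\sum_{k=1}^M\mathcal G(X)_{L_k}$. Let $L_{M+1},\dots,L_K$ be additional coupling operators, and let $\mathcal G(X)=\sum_{k=1}^K\mathcal G(X)_{L_k}$ be the generator of the system with all couplings $L_1,\dots,L_K$. If $\mathcal G(W_{n+1})+\sum_{k=M+1}^K\mathcal G(\widetilde W_n)_{L_k}\le -cW_{n+1}+c(d_{n+1}-d_n)$, then $\widetilde W_{n+1}$ is asymptotically ground-state stable for the system with couplings $L_1,\dots,L_K$.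
   Context: With couplings $L_1,\dots,L_K$, the density state (positive semidefinite, trace one) evolves by $\dot\rho_t=-i[H,\rho_t]+\sum_{k=1}^K\big(L_k\rho_tL_k^\dagger-\tfrac12L_k^\dagger L_k\rho_t-\tfrac12\rho_tL_k^\dagger L_k\big)$. Single-channel generator component: $\mathcal G(X)_{L_k}=L_k^\dagger XL_k-\tfrac12L_k^\dagger L_kX-\tfrac12XL_k^\dagger L_k$ (constants are identified with multiples of the identity). For $X$ commuting with $H$, $\frac{d}{dt}\operatorname{tr}(X\rho_t)=\operatorname{tr}(\mathcal G(X)\rho_t)$. An observable $X$ with smallest eigenvalue $d$ is asymptotically ground-state stable if $\operatorname{tr}(X\rho_t)\to d$ as $t\to\infty$ for every initial density state. *)

(* Defs.v *)
From HB Require Import structures.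
From mathcomp Require Import all_boot all_order all_algebra.
From mathcomp Require Import all_classical all_reals all_analysis.
From mathcomp Require Import complex.
Set Implicit Arguments. Unset Strict Implicit. Unset Printing Implicit Defensive.
Import Order.TTheory GRing.Theory Num.Theory.
Import numFieldNormedType.Exports.
Local Open Scope classical_set_scope.
Local Open Scope ring_scope.

Section QDefs.
Variable R : realType.
Local Notation C := R[i].
Variable n : nat.
Local Notation Mx := 'M[C]_n.

Definition adjmx (A : Mx) : Mx := (map_mx (@conjc R) A)^T.

Definition is_hermitian (A : Mx) : Prop := adjmx A = A.

(** positive semidefinite: <v, A v> >= 0 (in the num order of C, i.e. real and
    nonnegative) for every vector v *)
Definition psd (A : Mx) : Prop :=
  forall v : 'cV[C]_n, 0 <= ((map_mx (@conjc R) v)^T *m A *m v) 0 0.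

Definition loewner_le (A B : Mx) : Prop := psd (B - A).

Definition min_eigenvalue (A : Mx) (d : C) : Prop :=
  eigenvalue A d /\ forall a, eigenvalue A a -> d <= a.

Definition density (rho : Mx) : Prop := psd rho /\ \tr rho = 1.

Definition Gchan (L X : Mx) : Mx :=
  adjmx L *m X *m L - 2^-1 *: (adjmx L *m L *m X) - 2^-1 *: (X *m adjmx L *m L).

Definition Gsum (L : nat -> Mx) (a b : nat) (X : Mx) : Mx :=
  \sum_(a <= k < b.+1) Gchan (L k) X.

Definition lindblad (H : Mx) (L : nat -> Mx) (K : nat) (rho : Mx) : Mx :=
  - ('i%C *: (H *m rho - rho *m H)) +
  \sum_(1 <= k < K.+1)
     (L k *m rho *m adjmx (L k) - 2^-1 *: (adjmx (L k) *m L k *m rho)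
        - 2^-1 *: (rho *m adjmx (L k) *m L k)).

Definition lindblad_solution (H : Mx) (L : nat -> Mx) (K : nat)
    (rho : R -> Mx) : Prop :=
  forall (t : R) (i j : 'I_n),
    is_derive t 1 (fun s => complex.Re (rho s i j))
      (complex.Re (lindblad H L K (rho t) i j)) /\
    is_derive t 1 (fun s => complex.Im (rho s i j))
      (complex.Im (lindblad H L K (rho t) i j)).

(** X (with smallest eigenvalue d) is asymptotically ground-state stable for the
    system (H; L_1..L_K): tr(X rho_t) -> d for every trajectory starting from a
    density state *)
Definition ags_stable (H : Mx) (L : nat -> Mx) (K : nat) (X : Mx) (d : C)
    : Prop :=
  forall rho : R -> Mx, lindblad_solution H L K rho -> density (rho 0) ->
    (complex.Re (\tr (X *m rho t)) @[t --> +oo] --> complex.Re d) /\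
    (complex.Im (\tr (X *m rho t)) @[t --> +oo] --> complex.Im d).

End QDefs.

Definition partialW (R : realType) (n : nat) (W : nat -> 'M[R[i]]_n) (m : nat)
  : 'M[R[i]]_n := \sum_(1 <= l < m.+1) W l.

(* Main.v *)
Require Import Defs.
From HB Require Import structures.
From mathcomp Require Import all_boot all_order all_algebra.
From mathcomp Require Import all_classical all_reals all_analysis.
From mathcomp Require Import complex spectral ring lra.
Import Order.TTheory GRing.Theory Num.Theory.
Import numFieldNormedType.Exports.
Local Open Scope ring_scope.

(** The two hypotheses add up to [G(X) <= - c X] for [X := W~_(n+1) - d_(n+1) >= 0].
    Along a trajectory of density states, [f t := tr (X rho_t)] then satisfies
    [0 <= f] and [f' <= - c f], so [f] decays exponentially.

    That [rho_t] stays positive semidefinite is proved without semigroup theory.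
    With [B := - i H - sum_k L_k^* L_k / 2], an Euler step of length [h] is
    [(1 + h B) rho (1 + h B)^* + h sum_k L_k rho L_k^* - h^2 B rho B^*], hence
    positive up to second order.  The lower bound [<v, rho_t v> >= - eps e^(a t) |v|^2]
    therefore propagates beyond the infimum of the times at which it could fail;
    finally [eps] tends to [0]. *)

(** * Adjoints, quadratic forms and spectral facts about positive semidefinite matrices *)

Section Adjoint.
Set Implicit Arguments. Unset Strict Implicit. Unset Printing Implicit Defensive.
Variable R : realType.
Local Notation C := R[i].

(** Extends [adjmx] to rectangular matrices, so that vectors and operators share the same adjoint
    rules. *)
Definition ctr (m n : nat) (A : 'M[C]_(m, n)) : 'M[C]_(n, m) :=
  (map_mx (@conjc R) A)^T.

Lemma ctrE m n (A : 'M[C]_(m, n)) i j : ctr A i j = conjc (A j i).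
Proof. by rewrite !mxE. Qed.

Lemma adjmxE n (A : 'M[C]_n) : adjmx A = ctr A.
Proof. by []. Qed.

Lemma ctrK m n (A : 'M[C]_(m, n)) : ctr (ctr A) = A.
Proof. by apply/matrixP => i j; rewrite !ctrE conjcK. Qed.

Lemma ctrM m n p (A : 'M[C]_(m, n)) (B : 'M[C]_(n, p)) :
  ctr (A *m B) = ctr B *m ctr A.
Proof. by rewrite /ctr map_mxM trmx_mul. Qed.

Lemma ctrD m n (A B : 'M[C]_(m, n)) : ctr (A + B) = ctr A + ctr B.
Proof. by rewrite /ctr map_mxD linearD. Qed.

Lemma ctrN m n (A : 'M[C]_(m, n)) : ctr (- A) = - ctr A.
Proof. by rewrite /ctr map_mxN linearN. Qed.

Lemma ctrZ m n a (A : 'M[C]_(m, n)) : ctr (a *: A) = conjc a *: ctr A.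
Proof. by rewrite /ctr map_mxZ linearZ. Qed.

Lemma ctr1 n : ctr (1%:M : 'M[C]_n) = 1%:M.
Proof. by rewrite /ctr map_mx1 trmx1. Qed.

Lemma ctr_sum m n I (s : seq I) (F : I -> 'M[C]_(m, n)) :
  ctr (\sum_(k <- s) F k) = \sum_(k <- s) ctr (F k).
Proof.
elim/big_rec2: _ => [|k A B _ <-]; last by rewrite ctrD.
by rewrite /ctr map_mx0 trmx0.
Qed.

Definition qform n (A : 'M[C]_n) (v : 'cV[C]_n) : C := (ctr v *m A *m v) 0 0.

Lemma qformD n (A B : 'M[C]_n) v : qform (A + B) v = qform A v + qform B v.
Proof. by rewrite /qform mulmxDr mulmxDl mxE. Qed.

Lemma qformZ n a (A : 'M[C]_n) v : qform (a *: A) v = a * qform A v.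
Proof. by rewrite /qform -scalemxAr -scalemxAl mxE. Qed.

Lemma qformN n (A : 'M[C]_n) v : qform (- A) v = - qform A v.
Proof. by rewrite -scaleN1r qformZ mulN1r. Qed.

Lemma qform_sum n I (s : seq I) (F : I -> 'M[C]_n) v :
  qform (\sum_(k <- s) F k) v = \sum_(k <- s) qform (F k) v.
Proof.
elim/big_rec2: _ => [|k a B _ <-]; last by rewrite qformD.
by rewrite /qform mulmx0 mul0mx mxE.
Qed.

Lemma qform_conj n (A B : 'M[C]_n) v :
  qform (B *m A *m ctr B) v = qform A (ctr B *m v).
Proof. by rewrite /qform ctrM ctrK !mulmxA. Qed.

Lemma qform_ctr n (A : 'M[C]_n) v : qform (ctr A) v = conjc (qform A v).
Proof.
by rewrite /qform -ctrE !ctrM ctrK mulmxA.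
Qed.

Lemma qform_trace n (A : 'M[C]_n) v : qform A v = \tr (v *m ctr v *m A).
Proof. by rewrite -mulmxA mxtrace_mulC /mxtrace big_ord1. Qed.

Lemma qform_sumE n (A : 'M[C]_n) v :
  qform A v = \sum_i \sum_j conjc (v i 0) * A i j * v j 0.
Proof.
rewrite /qform mxE exchange_big; apply: eq_bigr => j _ /=.
by rewrite mxE big_distrl; apply: eq_bigr => i _ /=; rewrite ctrE.
Qed.

(** Stated for normal matrices because it serves skew-Hermitian ones as well as Hermitian ones. The
    rows of [U] are the adjoints of an orthonormal eigenbasis. *)
Lemma normal_diagonalizable n (A : 'M[C]_n) : A *m ctr A = ctr A *m A ->
  exists U : 'M[C]_n, exists D : 'rV[C]_n,
    [/\ U *m ctr U = 1%:M, ctr U *m U = 1%:M & A = ctr U *m diag_mx D *m U].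
Proof.
move=> nA; have ctrE' (B : 'M[C]_n) : map_mx Num.conj B^T = ctr B.
  by apply/matrixP => i j; rewrite !mxE.
have /orthomx_spectralP : A \is normalmx by apply/normalmxP; rewrite ctrE'.
have /unitarymxP := spectral_unitarymx A.
have := spectral_unit A; have := invmx_unitary (spectral_unitarymx A).
move: (spectralmx A) (spectral_diag A) => U D; rewrite ctrE' => iU uU UU AE.
exists U, D; split => //; last by rewrite -iU.
by rewrite -iU mulVmx.
Qed.

Lemma diag_qform n (A U : 'M[C]_n) (D : 'rV[C]_n) k :
  U *m ctr U = 1%:M -> A = ctr U *m diag_mx D *m U ->
  qform A (ctr (row k U)) = D 0 k.
Proof.
move=> UU ->; rewrite /qform ctrK !mulmxA -row_mul UU row1.
rewrite -[delta_mx 0 k *m diag_mx D *m U *m _]mulmxA.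
have -> : U *m ctr (row k U) = delta_mx k 0.
  apply/matrixP => i j; rewrite !ord1.
  have := congr1 (fun M : 'M[C]_n => M i k) UU.
  rewrite !mxE eqxx andbT => <-; apply: eq_bigr => l _; by rewrite !mxE.
rewrite -rowE row_diag_mx -scalemxAl mul_delta_mx mxE mxE.
by rewrite !eqxx mulr1.
Qed.

(** The skew-Hermitian matrix [A - ctr A] is unitarily diagonalizable. Its quadratic form is that of
    [A] minus the conjugate, which vanishes because the form of [A] is real; hence all its
    eigenvalues are zero. *)
Lemma psd_hermitian n (A : 'M[C]_n) : psd A -> ctr A = A.
Proof.
move=> pA; pose S : 'M[C]_n := A - ctr A.
have cS : ctr S = - S by rewrite /S ctrD ctrN ctrK opprB addrC.
have [|U [D [UU _ SE]]] := @normal_diagonalizable _ S.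
  by rewrite cS mulmxN mulNmx.
suff D0 : D = 0.
  have : S = 0 by rewrite SE D0 raddf0 mulmx0 mul0mx.
  by move/eqP; rewrite subr_eq0 => /eqP/esym.
apply/rowP => k; rewrite -(diag_qform k UU SE) /S qformD qformN qform_ctr mxE.
have := pA (ctr (row k U)); rewrite -/(qform _ _).
case: (qform _ _) => a b; rewrite lecE /= => /andP[/eqP -> _].
by rewrite oppr0 subrr.
Qed.

Lemma psd_diagonalizable n (A : 'M[C]_n) : psd A ->
  exists U : 'M[C]_n, exists D : 'rV[C]_n,
    [/\ U *m ctr U = 1%:M, ctr U *m U = 1%:M & A = ctr U *m diag_mx D *m U].
Proof. by move/psd_hermitian => hA; apply: normal_diagonalizable; rewrite hA. Qed.

(** In an eigenbasis of [A], the trace is the sum of the eigenvalues of [A], each weighted by the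
    form of [B] at the eigenvector. *)
Lemma psd_trace_ge0 n (A B : 'M[C]_n) : psd A -> psd B -> 0 <= \tr (A *m B).
Proof.
move=> pA pB; have [U [D [UU _ AE]]] := psd_diagonalizable pA.
rewrite AE -!mulmxA mxtrace_mulC -!mulmxA mul_diag_mx.
rewrite /mxtrace sumr_ge0 // => k _; rewrite mxE mulr_ge0 //.
  by rewrite -(diag_qform k UU AE); exact: pA.
suff -> : (U *m (B *m ctr U)) k k = qform B (ctr (row k U)) by exact: pB.
rewrite /qform ctrK mulmxA -row_mul.
rewrite !mxE; apply: eq_bigr => l _; by rewrite !mxE.
Qed.

Lemma psdD n (A B : 'M[C]_n) : psd A -> psd B -> psd (A + B).
Proof. by move=> pA pB v; rewrite -/(qform _ _) qformD addr_ge0 ?pA ?pB. Qed.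

Lemma psd_sum n (I : eqType) (s : seq I) (F : I -> 'M[C]_n) :
  (forall k, k \in s -> psd (F k)) -> psd (\sum_(k <- s) F k).
Proof.
move=> pF; rewrite big_seq; elim/big_ind: _ => //; last exact: psdD.
by move=> v; rewrite mulmx0 mul0mx mxE.
Qed.

Lemma psd_sub_min_eigenvalue n (A : 'M[C]_n) d :
  psd A -> min_eigenvalue A d -> psd (A - d%:M).
Proof.
move=> pA [_ dmin]; have [U [D [UU VU AE]]] := psd_diagonalizable pA.
have Dd k : d <= D 0 k.
  (* [eigenvalue] speaks of row vectors, so [row k U] itself is the witness; it is nonzero because
     its product with [ctr U] is a standard basis row. *)
  apply: dmin; apply/eigenvalueP; exists (row k U).
    rewrite AE !mulmxA -row_mul UU row1 -rowE row_diag_mx -scalemxAl.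
    by rewrite -rowE.
  apply/eqP => r0; have : row k U *m ctr U = 0 by rewrite r0 mul0mx.
  rewrite -row_mul UU row1 => /rowP/(_ k); rewrite !mxE !eqxx => /eqP.
  by rewrite oner_eq0.
have -> : A - d%:M = ctr U *m diag_mx (D - const_mx d) *m ctr (ctr U).
  rewrite raddfB /= diag_const_mx ctrK mulmxBr mulmxBl -AE.
  by rewrite mul_mx_scalar -scalemxAl VU scalemx1.
move=> v; rewrite -/(qform _ _) qform_conj; set w := ctr _ *m v.
rewrite qform_sumE sumr_ge0 // => i _; rewrite (bigD1 i) //= big1 ?addr0.
  rewrite !mxE eqxx mulr1n mulrAC mulrC mulr_ge0 ?subr_ge0 //.
  by rewrite mulrC -sqr_normc exprn_ge0.
by move=> j ji; rewrite !mxE eq_sym (negPf ji) mulr0n mulr0 mul0r.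
Qed.

End Adjoint.

(** * Real parts and norm bounds for quadratic forms *)

Section Trajectories.
Set Implicit Arguments. Unset Strict Implicit. Unset Printing Implicit Defensive.
Variable R : realType.
Local Notation C := R[i].
Local Notation Re := (@complex.Re R).
Local Notation Im := (@complex.Im R).

Lemma ReD (x y : C) : Re (x + y) = Re x + Re y.
Proof. by case: x => ? ?; case: y. Qed.

Lemma ReN (x : C) : Re (- x) = - Re x.
Proof. by case: x. Qed.

Lemma ReM (x y : C) : Re (x * y) = Re x * Re y - Im x * Im y.
Proof. by case: x => ? ?; case: y. Qed.

Lemma ReZ (a : R) (x : C) : Re ((a%:C)%C * x) = a * Re x.
Proof. by case: x => ? ? /=; rewrite mul0r subr0. Qed.

Lemma Re_sum I (s : seq I) (F : I -> C) :
  Re (\sum_(k <- s) F k) = \sum_(k <- s) Re (F k).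
Proof. by elim/big_rec2: _ => // k a b _ <-; rewrite ReD. Qed.

Variable n : nat.
Implicit Types (A B E : 'M[C]_n) (v : 'cV[C]_n).

(** An entrywise norm is used because its continuity reduces to that of the entries. *)
Definition mnorm E : R := \sum_i \sum_j (`|Re (E i j)| + `|Im (E i j)|).

Definition sqnorm v : R := \sum_i (Re (v i 0) ^+ 2 + Im (v i 0) ^+ 2).

Lemma mnorm_ge0 E : 0 <= mnorm E.
Proof. by rewrite sumr_ge0 // => i _; rewrite sumr_ge0 // => j _; rewrite addr_ge0. Qed.

Lemma sqnorm_ge0 v : 0 <= sqnorm v.
Proof. by rewrite sumr_ge0 // => i _; rewrite addr_ge0 ?sqr_ge0. Qed.

Lemma qform1 v : Re (qform 1%:M v) = sqnorm v.
Proof.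
rewrite /qform mulmx1 mxE Re_sum; apply: eq_bigr => i _.
by rewrite ctrE; case: (v i 0) => a b /=; rewrite !expr2 mulNr opprK.
Qed.

(** Termwise: the real and imaginary parts of [conjc (v i 0) * v j 0] are at most [sqnorm v] in
    absolute value, by the inequality between arithmetic and geometric means, which the four squares
    supply. *)
Lemma qform_mnorm E v : `|Re (qform E v)| <= mnorm E * sqnorm v.
Proof.
rewrite qform_sumE Re_sum (le_trans (ler_norm_sum _ _ _)) // mulr_suml.
apply: ler_sum => i _; rewrite Re_sum (le_trans (ler_norm_sum _ _ _)) // mulr_suml.
apply: ler_sum => j _.
have le_sqnorm k : Re (v k 0) ^+ 2 + Im (v k 0) ^+ 2 <= sqnorm v.
  rewrite /sqnorm (bigD1 k) //= lerDl sumr_ge0 // => l _.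
  by rewrite addr_ge0 ?sqr_ge0.
have := le_sqnorm i; have := le_sqnorm j; move: (sqnorm v) => N.
case: (v i 0) => a1 a2; case: (v j 0) => b1 b2; case: (E i j) => e1 e2 /=.
move=> Nb Na.
have x : `|a1 * b1 + a2 * b2| <= N.
  have := (sqr_ge0 (a1 + b1), sqr_ge0 (a1 - b1), sqr_ge0 (a2 + b2), sqr_ge0 (a2 - b2)).
  by move=> [[[? ?] ?] ?]; rewrite ler_norml; apply/andP; split; nra.
have y : `|a1 * b2 - a2 * b1| <= N.
  have := (sqr_ge0 (a1 + b2), sqr_ge0 (a1 - b2), sqr_ge0 (a2 + b1), sqr_ge0 (a2 - b1)).
  by move=> [[[? ?] ?] ?]; rewrite ler_norml; apply/andP; split; nra.
rewrite (_ : _ - _ = (a1 * b1 + a2 * b2) * e1 - (a1 * b2 - a2 * b1) * e2); last by ring.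
rewrite (le_trans (ler_normB _ _)) // !normrM mulrDl.
by rewrite lerD // mulrC ler_wpM2l.
Qed.

(** * The Lindblad equation: drift form, linearity, first-order expansion and Euler step *)

Variables (H : 'M[C]_n) (L : nat -> 'M[C]_n) (K : nat).
Local Notation Lind := (lindblad H L K).

Definition drift : 'M[C]_n :=
  - ('i%C *: H) - 2^-1 *: \sum_(1 <= k < K.+1) (ctr (L k) *m L k).

(** Hermiticity of [H] turns the sign of the Hamiltonian term in [ctr drift], so the commutator and
    the anticommutator split into a left and a right product. *)
Lemma lindblad_drift A : is_hermitian H ->
  Lind A = drift *m A + A *m ctr drift
           + \sum_(1 <= k < K.+1) (L k *m A *m ctr (L k)).
Proof.
rewrite /is_hermitian adjmxE => hH.
have half : conjc (2^-1 : C) = 2^-1 by rewrite conjc_inv conjc_nat.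
have iC : conjc ('i%C : C) = - 'i%C by apply/eqP; rewrite eq_complex /= oppr0 !eqxx.
have -> : ctr drift = 'i%C *: H - 2^-1 *: \sum_(1 <= k < K.+1) (ctr (L k) *m L k).
  rewrite /drift ctrD !ctrN !ctrZ hH iC half scaleNr opprK ctr_sum.
  by under eq_bigr do rewrite ctrM ctrK.
rewrite /lindblad /drift !mulmxBl !mulmxBr mulNmx -!scalemxAl -!scalemxAr.
rewrite mulmx_suml mulmx_sumr !big_split /= !sumrN -!scaler_sumr scalerBr.
rewrite (eq_bigr (fun k => A *m (ctr (L k) *m L k)) (fun k _ => esym (mulmxA _ _ _))).
move: ('i%C *: _) ('i%C *: _) (2^-1 *: _) (2^-1 *: _) (\sum_(_ <= _ < _) _).
by move=> a b p q s; apply/matrixP => i j; rewrite !mxE; ring.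
Qed.

Lemma lindbladZ a A : Lind (a *: A) = a *: Lind A.
Proof.
rewrite /lindblad [RHS]scalerDr [in RHS]scalerN scaler_sumr; congr (- _ + _).
  by rewrite -scalemxAr -scalemxAl -scalerBr !scalerA mulrC.
apply: eq_bigr => k _; rewrite !scalerBr -!scalemxAr -!scalemxAl !scalerA.
by rewrite mulrC.
Qed.

Lemma lindbladD A B : Lind (A + B) = Lind A + Lind B.
Proof.
rewrite /lindblad [RHS]addrACA -opprD -scalerDr -big_split; congr (- (_ *: _) + _).
  by rewrite mulmxDr mulmxDl opprD addrACA.
apply: eq_bigr => k _ /=; rewrite !mulmxDr !mulmxDl !scalerDr !opprD.
by rewrite [RHS]addrACA; congr (_ + _); rewrite addrACA.
Qed.

Lemma lindblad_solutionZ rho a : lindblad_solution H L K rho ->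
  lindblad_solution H L K (fun t => a *: rho t).
Proof.
move=> sol t i j; have [dR dI] := sol t i j; rewrite lindbladZ.
have ReE B : Re ((a *: B) i j) = Re a * Re (B i j) - Im a * Im (B i j).
  by rewrite mxE ReM.
have ImE B : Im ((a *: B) i j) = Re a * Im (B i j) + Im a * Re (B i j).
  by rewrite mxE; case: {sol dR dI ReE} a (B i j) => ? ? [].
split.
  rewrite ReE (_ : (fun s => _) = (Re a \*: (fun s => Re (rho s i j)))
                               - (Im a \*: (fun s => Im (rho s i j)))).
    by apply: is_deriveB; apply: is_deriveZ.
  by apply/funext => s; rewrite ReE.
rewrite ImE (_ : (fun s => _) = (Re a \*: (fun s => Im (rho s i j)))
                             + (Im a \*: (fun s => Re (rho s i j)))).
  by apply: is_deriveD; apply: is_deriveZ.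
by apply/funext => s; rewrite ImE.
Qed.

(** Serves three choices of [A]: an observable, a scalar (conservation of trace), and [v *m ctr v]
    (quadratic forms, through [qform_trace]). *)
Lemma solution_trace_derive rho A (t : R) : lindblad_solution H L K rho ->
  is_derive t 1 (fun s => Re (\tr (A *m rho s))) (Re (\tr (A *m Lind (rho t)))).
Proof.
move=> sol.
have trE B : Re (\tr (A *m B)) =
    \sum_i \sum_j (Re (A i j) * Re (B j i) - Im (A i j) * Im (B j i)).
  rewrite Re_sum; apply: eq_bigr => i _; rewrite mxE Re_sum.
  by apply: eq_bigr => j _; rewrite ReM.
rewrite trE (_ : (fun s => _) = \sum_i \sum_j
    ((Re (A i j) \*: (fun s => Re (rho s j i)))
     - (Im (A i j) \*: (fun s => Im (rho s j i))))); last first.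
  apply/funext => s; rewrite trE fct_sumE; apply: eq_bigr => i _.
  by rewrite fct_sumE; apply: eq_bigr => j _.
apply: is_derive_sum => i; apply: is_derive_sum => j.
have [dR dI] := sol t j i.
by apply: is_deriveB; apply: is_deriveZ.
Qed.

(** The remainder is a matrix, so [del] does not depend on the vector at which a quadratic form is
    later evaluated. By Caratheodory, each entry has a slope function continuous at [s]; [E] is the
    slope matrix minus its value at [s]. *)
Lemma solution_expansion rho s (e : R) : lindblad_solution H L K rho -> 0 < e ->
  exists2 del : R, 0 < del & forall z, `|z - s| < del -> exists2 E,
    rho z = rho s + ((z - s)%:C)%C *: (Lind (rho s) + E) & mnorm E <= e.
Proof.
move=> sol e0.
have carR (ij : 'I_n * 'I_n) := (is_derive1_caratheodory _ _ _).1 (sol s ij.1 ij.2).1.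
have carI (ij : 'I_n * 'I_n) := (is_derive1_caratheodory _ _ _).1 (sol s ij.1 ij.2).2.
have [g Hg] := choice carR; have [k Hk] := choice carI.
move: (Lind (rho s)) Hg Hk => Lam Hg Hk {carR carI}.
pose E z : 'M[C]_n := \matrix_(i, j) (g (i, j) z +i* k (i, j) z)%C - Lam.
have mE : {for s, continuous (fun z => mnorm (E z))}.
  rewrite /mnorm; apply: cvg_big => [|i _]; first exact: add_continuous.
  apply: cvg_big => [|j _]; first exact: add_continuous.
  have [_ cg _] := Hg (i, j); have [_ ck _] := Hk (i, j).
  have ReE z : Re (E z i j) = g (i, j) z - Re (Lam i j).
    by rewrite !mxE; case: (Lam i j).
  have ImE z : Im (E z i j) = k (i, j) z - Im (Lam i j).
    by rewrite !mxE; case: (Lam i j).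
  rewrite ReE ImE; under eq_fun do rewrite ReE ImE.
  by apply: cvgD; apply: cvg_norm; apply: cvgB => //; exact: cvg_cst.
have Es0 : mnorm (E s) = 0.
  rewrite /mnorm big1 // => i _; rewrite big1 // => j _; rewrite !mxE.
  have [_ _ ->] := Hg (i, j); have [_ _ ->] := Hk (i, j).
  by case: (Lam i j) => a b /=; rewrite !subrr normr0 addr0.
have /cvgrPdist_lt/(_ _ e0) := mE; rewrite Es0.
move=> /nbhs_ballP[del /= del0 Hdel]; exists del => // z zs.
exists (E z); last first.
  have : `|0 - mnorm (E z)| < e by apply: Hdel; rewrite /ball /= distrC.
  by rewrite sub0r normrN ger0_norm ?mnorm_ge0 // => /ltW.
rewrite /E [Lam + _]addrC addrNK; apply/matrixP => i j; rewrite !mxE.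
have [gE _ _] := Hg (i, j); have [kE _ _] := Hk (i, j).
have := gE z; have := kE z; rewrite /=.
case: (rho z i j) (rho s i j) => a b [a' b'] /= kz gz.
apply/eqP; rewrite eq_complex /=; apply/andP; split; apply/eqP.
  by rewrite mul0r subr0 mulrC -gz; ring.
by rewrite mul0r addr0 mulrC -kz; ring.
Qed.

(** In the Kraus-type decomposition only the second-order term can be negative, and [qform_mnorm]
    bounds it. The hypothesis concerns real parts only, so that it also suits non-Hermitian [A]. *)
Lemma qform_step_lower A h v : is_hermitian H -> (forall w, 0 <= Re (qform A w)) ->
  0 <= h ->
  - (h ^+ 2 * mnorm (drift *m A *m ctr drift) * sqnorm v)
    <= Re (qform (A + (h%:C)%C *: Lind A) v).
Proof.
move=> hH pA h0; pose B := drift; pose B1 : 'M[C]_n := 1%:M + (h%:C)%C *: B.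
have -> : A + (h%:C)%C *: Lind A = B1 *m A *m ctr B1
   - ((h ^+ 2)%:C)%C *: (B *m A *m ctr B)
   + (h%:C)%C *: \sum_(1 <= k < K.+1) (L k *m A *m ctr (L k)).
  rewrite lindblad_drift // scalerDr addrA; congr (_ + _).
  rewrite /B1 /B; move: drift => {B B1} B; rewrite ctrD ctr1 ctrZ.
  rewrite conjc_real mulmxDl mul1mx -scalemxAl.
  rewrite mulmxDr mulmx1 -scalemxAr mulmxDl -scalemxAl scalerDr scalerDr scalerA.
  rewrite -rmorphM -expr2.
  move: (_ *: (B *m A)) (_ *: (A *m ctr B)) (_ *: (B *m A *m ctr B)).
  by move=> x y z; apply/matrixP => i j; rewrite !mxE; ring.
rewrite !qformD qformN !qformZ !ReD ReN !ReZ qform_sum Re_sum !qform_conj.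
have := pA (ctr B1 *m v); have := qform_mnorm (B *m A *m ctr B) v.
rewrite qform_conj ler_norml => /andP[_ le2] ge1.
have ge3 : 0 <= \sum_(1 <= k < K.+1) Re (qform (L k *m A *m ctr (L k)) v).
  by rewrite sumr_ge0 // => k _; rewrite qform_conj.
rewrite -mulrA.
have := mulr_ge0 h0 ge3; have := ler_wpM2l (sqr_ge0 h) le2.
rewrite -/B; lra.
Qed.

(* A forward Euler step is a Kraus map up to a term of second order; the
   growing margin [eps * expR (alpha * t)] absorbs that term. *)
Lemma solution_lower_step rho s eps (alpha := mnorm (Lind 1%:M) + 1) :
  is_hermitian H -> lindblad_solution H L K rho -> 0 < eps -> 0 <= s ->
  (forall v, - (eps * expR (alpha * s) * sqnorm v) <= Re (qform (rho s) v)) ->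
  exists2 del : R, 0 < del & forall z, s <= z < s + del -> forall v,
    - (eps * expR (alpha * z) * sqnorm v) <= Re (qform (rho z) v).
Proof.
move=> hH sol eps0 s0 Ps; set kap := eps * expR (alpha * s) in Ps.
have kap0 : 0 < kap by rewrite mulr_gt0 ?expR_gt0.
(* Adding the margin [kap] to [rho s] makes the real part of the form nonnegative, as the Euler step
   requires. *)
pose A : 'M[C]_n := rho s + (kap%:C)%C *: 1%:M.
have pA w : 0 <= Re (qform A w).
  by rewrite qformD qformZ ReD ReZ qform1 -lerBlDr sub0r.
set cA := mnorm (drift *m A *m ctr drift).
have cA0 : 0 <= cA := mnorm_ge0 _.
have [del del0 Hdel] := solution_expansion s sol (divr_gt0 kap0 (ltr0Sn _ 1)).
have cA1 : 0 < cA + 1 by rewrite ltr_wpDl.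
(* The second bound gives [h * cA <= kap / 2]; the added 1 keeps the denominator positive. *)
exists (Num.min del (kap / 2 / (cA + 1))).
  by rewrite lt_min del0 !divr_gt0.
move=> z /andP[sz zs] v; set h := z - s.
have h0 : 0 <= h by rewrite subr_ge0.
have : h < Num.min del (kap / 2 / (cA + 1)) by rewrite ltrBlDl.
rewrite lt_min => /andP[hdel]; rewrite ltr_pdivlMr // => hcA.
have [|E rhoz mE] := Hdel z; first by rewrite ger0_norm.
have := qform_step_lower v hH pA h0.
have -> : A + (h%:C)%C *: Lind A
   = rho z + (kap%:C)%C *: 1%:M + ((h * kap)%:C)%C *: Lind 1%:M - (h%:C)%C *: E.
  rewrite rhoz /A lindbladD lindbladZ -/h (rmorphM _ h kap) /=.
  move: (Lind (rho s)) (Lind 1%:M) => P Q; move: (1%:M : 'M[C]_n) => I.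
  by apply/matrixP => i j; rewrite !mxE; ring.
rewrite !qformD qformN !qformZ !ReD ReN !ReZ qform1 -/cA.
have /ler_normlP[] := qform_mnorm E v; have /ler_normlP[_] := qform_mnorm (Lind 1%:M) v.
have N0 := sqnorm_ge0 v.
(* The growth of the margin is [kap * alpha * h] to first order. In [alpha], the norm of [Lind 1%:M]
   pays for the shift by [kap], and the extra 1 pays two halves: the remainder [E] and the
   second-order term. *)
have ineq : kap * (1 + alpha * h) <= eps * expR (alpha * z).
  rewrite (_ : alpha * z = alpha * s + alpha * h); last by rewrite /h; ring.
  by rewrite expRD mulrA; apply: (ler_wpM2l (ltW kap0)); exact: expR_ge1Dx.
have mE' : mnorm E * sqnorm v <= kap / 2 * sqnorm v by rewrite ler_wpM2r.
have := ler_wpM2r N0 ineq; rewrite /alpha.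
move: (Re (qform (rho z) v)) (Re (qform E v)) (Re (qform (Lind 1%:M) v)).
move: (sqnorm v) (mnorm (Lind _)) N0 mE' => N m N0 mE' r x y i1 i2 i3 i4 i5.
have j1 : h * - x <= h * (kap / 2 * N) by rewrite ler_wpM2l // (le_trans i3).
have j2 : h * kap * y <= h * kap * (m * N) by rewrite ler_wpM2l // mulr_ge0 // ltW.
have j3 : h * (h * cA) * N <= h * (kap / 2) * N.
  by rewrite ler_wpM2r // ler_wpM2l // ltW // (le_lt_trans _ hcA) // ler_wpM2l // lerDl.
nra.
Qed.

End Trajectories.

(** * Positivity of trajectories, duality with the generator, and exponential decay *)

Section Stability.
Set Implicit Arguments. Unset Strict Implicit. Unset Printing Implicit Defensive.
Variable R : realType.
Local Notation C := R[i].
Local Notation Re := (@complex.Re R).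
Local Notation Im := (@complex.Im R).
Variables (n : nat) (H : 'M[C]_n) (L : nat -> 'M[C]_n) (K : nat).
Local Notation Lind := (lindblad H L K).

Lemma is_derive1_continuous (f : R -> R) (x df : R) :
  is_derive x 1 f df -> {for x, continuous f}.
Proof. by move=> [fx _]; apply/differentiable_continuous/derivable1_diffP. Qed.

Lemma solution_lower rho (eps : R) (alpha := mnorm (Lind 1%:M) + 1) :
  is_hermitian H -> lindblad_solution H L K rho -> 0 < eps ->
  (forall v, 0 <= Re (qform (rho 0) v)) -> forall t, 0 <= t -> forall v,
    - (eps * expR (alpha * t) * sqnorm v) <= Re (qform (rho t) v).
Proof.
move=> hH sol eps0 rho0.
pose P t := forall v, - (eps * expR (alpha * t) * sqnorm v) <= Re (qform (rho t) v).
apply: contrapT => notP; pose F := [set t | 0 <= t /\ ~ P t]%classic.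
have F0 : (F !=set0)%classic.
  apply: contrapT => F0; apply: notP => t t0; apply: contrapT => nPt.
  by apply: F0; exists t.
have lbF : lbound F 0 by move=> t [].
have hF : has_inf F by split=> //; exists 0.
set s := inf F; have s0 : 0 <= s by apply: lb_le_inf.
have Ps : P s.
  move=> v; have [s00|sN0] := eqVneq s 0.
    rewrite s00 mulr0 expR0 mulr1 (le_trans _ (rho0 v)) // oppr_le0.
    by rewrite mulr_ge0 ?sqnorm_ge0 // ltW.
  have {sN0} sgt0 : 0 < s by rewrite lt_neqAle eq_sym sN0.
  rewrite leNgt; apply/negP => lt_s.
  pose phi z := Re (qform (rho z) v) + eps * expR (alpha * z) * sqnorm v.
  have cphi : {for s, continuous phi}.
    apply: cvgD.
      under eq_fun do rewrite qform_trace; rewrite qform_trace.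
      exact: (is_derive1_continuous (solution_trace_derive _ _ sol)).
    apply: cvgM; last exact: cvg_cst.
    apply: cvgM; first exact: cvg_cst.
    apply: (@continuous_comp _ _ _ (fun z => alpha * z) expR); last first.
      exact: continuous_expR.
    by apply: cvgM; [exact: cvg_cst|exact: cvg_id].
  have phis : phi s < 0 by rewrite /phi addrC -ltrBrDl sub0r.
  have /nbhs_ballP[del /= del0 Hdel] : \forall z \near s, phi z < 0.
    exact: cvgr_lt cphi _ phis.
  (* By continuity a failure at [s] persists at this earlier time; the minimum with [s] keeps [z]
     nonnegative, so [z] lies in [F] below its infimum. *)
  pose z := s - Num.min (del / 2) s.
  have m0 : 0 < Num.min (del / 2) s by rewrite lt_min divr_gt0.
  have zs : z < s by rewrite /z ltrBlDr ltrDl.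
  have phiz : phi z < 0.
    apply: Hdel; rewrite /ball /= /z opprB addrC addrNK gtr0_norm // gt_min.
    by apply/orP; left; rewrite ltr_pdivrMr // ltr_pMr // ltr1n.
  have : F z.
    split; first by rewrite subr_ge0 ge_min lexx orbT.
    by move=> /(_ v); move: phiz; rewrite /phi; lra.
  by move=> /(ge_inf hF.2); rewrite -/s leNgt zs.
(* The bound now extends to [s <= z < s + del], although the infimum property yields a failing time
   there. *)
have [del del0 Hdel] := solution_lower_step hH sol eps0 s0 Ps.
have [t Ft ts] := inf_adherent del0 hF.
case: (Ft) => t0; apply; apply: Hdel.
by rewrite -/s in ts; rewrite ts andbT; apply: ge_inf => //; exact: hF.2.
Qed.

Lemma solution_Re_qform_ge0 rho t v :
  is_hermitian H -> lindblad_solution H L K rho ->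
  (forall w, 0 <= Re (qform (rho 0) w)) -> 0 <= t -> 0 <= Re (qform (rho t) v).
Proof.
move=> hH sol rho0 t0; apply/ler_addgt0Pl => e e0.
set a := mnorm (Lind 1%:M) + 1; pose c := expR (a * t) * sqnorm v + 1.
have c0 : 0 <= expR (a * t) * sqnorm v by rewrite mulr_ge0 ?expR_ge0 ?sqnorm_ge0.
have c1 : 0 < c by rewrite ltr_wpDl.
have := solution_lower hH sol (divr_gt0 e0 c1) rho0 t0 v; rewrite -/a.
have : e / c * (expR (a * t) * sqnorm v) <= e.
  by rewrite mulrAC ler_pdivrMr // ler_wpM2l ?(ltW e0) // lerDl.
rewrite mulrA; lra.
Qed.

(* [rho], [i rho] and [- i rho] are all solutions, so Hermiticity of [rho t]
   needs no separate argument. *)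
Lemma solution_psd rho t :
  is_hermitian H -> lindblad_solution H L K rho ->
  psd (rho 0) -> 0 <= t -> psd (rho t).
Proof.
move=> hH sol rho0 t0 v; rewrite -/(qform _ _).
have q0 w : Im (qform (rho 0) w) = 0 /\ 0 <= Re (qform (rho 0) w).
  by have := rho0 w; rewrite -/(qform _ _) lecE => /andP[/eqP].
have ReiE A w : Re (qform ('i%C *: A) w) = - Im (qform A w).
  by rewrite qformZ mulrC ReiNIm.
have ReNiE A w : Re (qform (- 'i%C *: A) w) = Im (qform A w).
  by rewrite scaleNr qformN ReN ReiE opprK.
rewrite lecE /= (solution_Re_qform_ge0 _ hH sol) ?andbT // => [|w]; last first.
  by case: (q0 w).
(* The vanishing of the imaginary part is split into two inequalities, one from each of the
   solutions [i rho] and [- i rho]. *)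
rewrite eq_le -oppr_ge0 -ReiE -ReNiE.
rewrite (solution_Re_qform_ge0 _ hH (lindblad_solutionZ 'i%C sol)) //=.
  rewrite (solution_Re_qform_ge0 _ hH (lindblad_solutionZ (- 'i%C) sol)) //=.
  by move=> w; rewrite ReNiE (q0 w).1.
by move=> w; rewrite ReiE (q0 w).1 oppr0.
Qed.

Lemma GsumD M N (A B : 'M[C]_n) : Gsum L M N (A + B) = Gsum L M N A + Gsum L M N B.
Proof.
rewrite /Gsum -big_split; apply: eq_bigr => k _ /=.
rewrite /Gchan !mulmxDr !mulmxDl !scalerDr !opprD.
by rewrite [RHS]addrACA; congr (_ + _); rewrite addrACA.
Qed.

(** On a scalar the two halves of the anticommutator cancel the jump term. This gives both trace
    conservation and the freedom to shift observables by constants. *)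
Lemma Gsum_scalar M N a : Gsum L M N (a%:M : 'M[C]_n) = 0.
Proof.
rewrite /Gsum big1 // => k _; rewrite /Gchan.
rewrite !mul_mx_scalar mul_scalar_mx -!scalemxAl -addrA -opprD -scalerDl.
by rewrite -[2^-1]div1r -splitr scale1r subrr.
Qed.

Lemma Gsum_cat M (A : 'M[C]_n) : (M <= K)%N ->
  Gsum L 1 K A = Gsum L 1 M A + Gsum L M.+1 K A.
Proof. by move=> MK; rewrite /Gsum (big_cat_nat (n := M.+1)). Qed.

(** Cyclicity of the trace moves the couplings from the state to the observable; the commutator term
    drops out because [X] commutes with [H]. *)
Lemma trace_lindblad (X A : 'M[C]_n) : X *m H = H *m X ->
  \tr (X *m Lind A) = \tr (Gsum L 1 K X *m A).
Proof.
move=> XH; rewrite /lindblad mulmxDr mulmxN -scalemxAr mulmxBr mxtraceD.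
rewrite raddfN /= mxtraceZ raddfB /= !mulmxA XH -[H *m X *m A]mulmxA mxtrace_mulC.
rewrite subrr mulr0 oppr0 add0r mulmx_sumr mulmx_suml !raddf_sum.
apply: eq_bigr => k _ /=; rewrite /Gchan adjmxE.
rewrite !mulmxBr !mulmxBl !raddfB /= -!scalemxAr -!scalemxAl !mxtraceZ.
rewrite [LHS]addrAC; congr (_ - _ * _ - _ * _).
- by rewrite !mulmxA mxtrace_mulC !mulmxA.
- by rewrite -[ctr (L k) *m L k *m X *m A]mulmxA [RHS]mxtrace_mulC !mulmxA.
- by rewrite !mulmxA.
Qed.

(** Duality is applied to scalar observables [a%:M], whose derivative is zero; [a = 1] and [a = i]
    recover the real and imaginary parts. *)
Lemma solution_trace rho t : lindblad_solution H L K rho -> \tr (rho t) = \tr (rho 0).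
Proof.
move=> sol.
have cst a : Re (a * \tr (rho t)) = Re (a * \tr (rho 0)).
  have trE B : a * \tr B = \tr (a%:M *m B) by rewrite mul_scalar_mx linearZ.
  rewrite !trE; apply: (@is_derive_0_is_cst _ (fun s => Re (\tr (a%:M *m rho s)))) => s.
  have := solution_trace_derive a%:M s sol.
  by rewrite trace_lindblad ?scalar_mxC // Gsum_scalar mul0mx mxtrace0.
have := cst 1; have := cst 'i%C; rewrite !(mulrC 'i%C) !ReiNIm !mul1r.
case: (\tr _) (\tr _) => a b [a' b'] /= /eqP; rewrite eqr_opp => /eqP -> ->.
by [].
Qed.

(** The product [expR (c * s) * f s] has nonpositive derivative for [s >= 0], so the mean value
    theorem bounds it by its value at 0. *)
Lemma gronwall_decay (f df : R -> R) (c t : R) :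
  (forall s : R, is_derive s 1 f (df s)) -> (forall s, 0 <= s -> df s <= - c * f s) ->
  0 <= t -> f t <= f 0 * expR (- (c * t)).
Proof.
move=> fd dle t0.
pose g s := expR (c * s) * f s; pose dg s := expR (c * s) * (df s + c * f s).
have gd (s : R) : is_derive s 1 g (dg s).
  have e1 : is_derive s 1 (fun s => c * s) c.
    by apply: is_derive_eq (is_deriveZ c (is_derive_id s 1)) _;
      rewrite /GRing.scale /= mulr1.
  have e2 := is_derive1_comp (is_derive_expR (c * s)) e1.
  by apply: is_derive_eq (is_deriveM e2 (fd s)) _; rewrite /dg /GRing.scale /=; ring.
have [|x] := @MVT_segment R g dg 0 t t0 (fun x _ => gd x).
  by apply: derivable_within_continuous => x _; case: (gd x).
rewrite in_itv /= => /andP[x0 _] /eqP; rewrite subr0 subr_eq => /eqP gE.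
have : g t <= g 0.
  rewrite gE gerDr mulr_le0_ge0 // /dg mulr_ge0_le0 ?expR_ge0 //.
  by rewrite -lerBrDr sub0r -mulNr dle.
rewrite /g mulr0 expR0 mul1r => gle.
by rewrite expRN ler_pdivlMr ?expR_gt0 // mulrC.
Qed.

Lemma decay_ags_stable (V : 'M[C]_n) (d : C) (c : R) (X : 'M[C]_n := V - d%:M) :
  is_hermitian H -> V *m H = H *m V -> psd X -> 0 < c ->
  loewner_le (Gsum L 1 K X) (- ((c%:C)%C *: X)) ->
  ags_stable H L K V d.
Proof.
move=> hH VH pX c0 GX rho sol [rho0 tr1].
have tr_rho t : \tr (rho t) = 1 by rewrite (solution_trace _ sol).
have XH : X *m H = H *m X by rewrite /X mulmxBl mulmxBr VH scalar_mxC.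
pose f t := Re (\tr (X *m rho t)).
have Xge0 t : 0 <= t -> 0 <= \tr (X *m rho t).
  by move=> t0; apply: psd_trace_ge0 => //; apply: solution_psd sol _ t0.
have trV t : \tr (V *m rho t) = \tr (X *m rho t) + d.
  by rewrite /X mulmxBl linearB /= mul_scalar_mx linearZ /= tr_rho mulr1 subrK.
have fge0 t : 0 <= t -> 0 <= f t by move/Xge0; rewrite lecE => /andP[].
have fle t : 0 <= t -> f t <= f 0 * expR (- (c * t)).
  apply: (gronwall_decay (fun s => solution_trace_derive X s sol)) => s s0.
  rewrite trace_lindblad //.
  (* Pairing the matrix inequality with the positive state [rho s] gives the scalar differential
     inequality. *)
  have := psd_trace_ge0 GX (solution_psd hH sol rho0 s0).
  rewrite mulmxBl mulNmx -scalemxAl linearB linearN linearZ /= lecE => /andP[_] /=.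
  by rewrite ReD !ReN ReZ subr_ge0 mulNr.
have lim_expR : (expR (- (c * t)) @[t --> +oo] --> (0 : R))%classic.
  apply: (cvg_comp (fun t => c * t) _ _ (@cvgr_expR R)).
  apply/cvgryPge => A; by near=> t; rewrite mulrC -ler_pdivrMr.
have lim_f : (f t @[t --> +oo] --> (0 : R))%classic.
  apply: (@squeeze_cvgr _ _ _ _ (cst 0) (fun t => f 0 * expR (- (c * t)))).
  - near=> t; have t0 : 0 <= t by near: t; exact: nbhs_pinfty_ge.
    by rewrite /= fge0 ?fle.
  - exact: cvg_cst.
  - by have := cvgM (cvg_cst (f 0)) lim_expR; rewrite mulr0; apply.
split.
  under eq_fun do rewrite trV ReD.
  by have := cvgD lim_f (cvg_cst (Re d)); rewrite add0r; apply.
(* For [t >= 0] the trace of [X *m rho t] is real, so the imaginary part is eventually constant. *)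
apply: cvg_near_cst; near=> t; rewrite trV.
have t0 : 0 <= t by near: t; exact: nbhs_pinfty_ge.
have := Xge0 t t0; rewrite lecE => /andP[/eqP /=].
by case: (\tr _) => a b /= -> _; case: (d) => d1 d2 /=; rewrite add0r.
Unshelve. all: by end_near. Qed.

End Stability.

Theorem theorem19 (R : realType) (dim : nat) (Ham : 'M[R[i]]_dim)
  (N : nat) (W : nat -> 'M[R[i]]_dim) (d : nat -> R[i])
  (n M K : nat) (L : nat -> 'M[R[i]]_dim) (c : R) :
  is_hermitian Ham ->
  (forall l, (1 <= l <= N)%N -> W l *m Ham = Ham *m W l) ->
  (forall l, (1 <= l <= N)%N -> psd (W l) /\ min_eigenvalue (W l) 0) ->
  (forall m, (1 <= m <= N)%N -> min_eigenvalue (partialW W m) (d m)) ->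
  (1 <= n)%N -> (n < N)%N -> (M <= K)%N ->
  0 < c ->
  loewner_le (Gsum L 1 M (partialW W n - (d n)%:M))
             (- ((c%:C)%C *: (partialW W n - (d n)%:M))) ->
  loewner_le (Gsum L 1 K (W n.+1) + Gsum L M.+1 K (partialW W n))
             (- ((c%:C)%C *: W n.+1) + ((c%:C)%C * (d n.+1 - d n))%:M) ->
  ags_stable Ham L K (partialW W n.+1) (d n.+1).
Proof.
move=> hH comm hW hd n1 nN MK c0 hM hK.
have leN l : l \in index_iota 1 n.+2 -> (1 <= l <= N)%N.
  by rewrite mem_index_iota => /andP[-> /= ln]; exact: leq_trans nN.
apply: (decay_ags_stable (c := c) hH _ _ c0).
- rewrite /partialW mulmx_suml mulmx_sumr big_seq [RHS]big_seq.
  by apply: eq_bigr => l /leN; exact: comm.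
- apply: psd_sub_min_eigenvalue; last exact: hd.
  by apply: psd_sum => l /leN /hW[].
rewrite /loewner_le.
(* The required slack is the sum of the slacks of the two hypotheses: [Gsum] kills scalars,
   [Gsum_cat] splits the couplings at [M], and [c * (d n.+1 - d n)] accounts for the change of
   ground level. *)
have -> : - ((c%:C)%C *: (partialW W n.+1 - (d n.+1)%:M))
          - Gsum L 1 K (partialW W n.+1 - (d n.+1)%:M)
  = (- ((c%:C)%C *: (partialW W n - (d n)%:M)) - Gsum L 1 M (partialW W n - (d n)%:M))
  + (- ((c%:C)%C *: W n.+1) + ((c%:C)%C * (d n.+1 - d n))%:M
     - (Gsum L 1 K (W n.+1) + Gsum L M.+1 K (partialW W n))).
  have -> : partialW W n.+1 = partialW W n + W n.+1 by rewrite /partialW big_nat_recr.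
  rewrite -!(raddfN (@scalar_mx _ _)) !GsumD !Gsum_scalar !addr0 (Gsum_cat L _ MK).
  move: (partialW W n) (Gsum _ _ _ _) (Gsum _ _ _ _) (Gsum _ _ _ _) => V g1 g2 g3.
  by apply/matrixP => i j; rewrite !mxE; case: (i == j); rewrite ?mulr1n ?mulr0n; ring.
exact: (psdD hM hK).
Qed.
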